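(* Let $(U,D_U,m_U)$ and $(A,D_A,m_A)$ be sets with partial multiplications and with mutual actions $(\alpha,u)\mapsto\alpha\cdot u\in U$ and $(\alpha,u)\mapsto\alpha^u\in A$ defined on $H\subseteq A\times U$. Let $E\subseteq U\times A$ and assume: - $(\alpha\cdot u,\alpha^u)\in E$ whenever $(\alpha,u)\in H$; - $(u,\alpha)\in E$ and $(v,u)\in D_U$ imply $(vu,\alpha)\in E$; - $(u,\alpha)\in E$ and $(\alpha,\beta)\in D_A$ imply $(u,\alpha\beta)\in E$. Put on $E$ the partial multiplication $$(u,\alpha)(v,\beta)=(u(\alpha\cdot v),\ \alpha^v\beta),$$ where the left side is defined if and only if all of $(\alpha,v)\in H$, $(u,\alpha\cdot v)\in D_U$ and $(\alpha^v,\beta)\in D_A$ hold. Then the following hold. (iii) If $U$ and $A$ are both right associative and $(a\Rightarrow)$, $(b\Rightarrow)$, $(c\Leftarrow)$ and $(d\Leftarrow)$ all hold, then the partial multiplication on $E$ is right associative. (iv) If $U$ and $A$ are both left associative and $(a\Leftarrow)$, $(b\Leftarrow)$, $(c\Rightarrow)$ and $(d\Rightarrow)$ all hold, then the partial multiplication on $E$ is left associative. (v) If $U$ and $A$ are both associative and all eight of $(a\Rightarrow),(a\Leftarrow),\dots,(d\Rightarrow),(d\Leftarrow)$ hold, then the partial multiplication on $E$ is associative.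
   Context: A set with partial multiplication is a triple $(X,D,m)$ with $X$ a set, $D\subseteq X\times X$ and $m:D\to X$ a function; write $xDy$ (''$xy$ is defined'') for $(x,y)\in D$ and $xy$ for $m(x,y)$. Right associative: $xDy$ and $(xy)Dz$ together imply that $yDz$ and $xD(yz)$ hold and $(xy)z=x(yz)$. Left associative: $yDz$ and $xD(yz)$ together imply that $xDy$ and $(xy)Dz$ hold and $(xy)z=x(yz)$. Associative: both. Mutual actions defined on $H$ are simply two functions $H\to U$, $(\alpha,u)\mapsto\alpha\cdot u$, and $H\to A$, $(\alpha,u)\mapsto\alpha^u$, with no further properties assumed. Consider the four identities (for $\alpha,\beta\in A$, $u,v\in U$): (a) $(\alpha\beta)\cdot u=\alpha\cdot(\beta\cdot u)$; (b) $(\alpha\beta)^u=\alpha^{\beta\cdot u}\beta^u$; (c) $\alpha\cdot(uv)=(\alpha\cdot u)(\alpha^u\cdot v)$; (d) $\alpha^{uv}=(\alpha^u)^v$. For $x\in\{a,b,c,d\}$, $(x\Rightarrow)$ is the assumption that whenever the left side of identity $(x)$ and its intermediate products are defined, then the right side and all its intermediate products are defined and the equality holds; $(x\Leftarrow)$ is the assumption that whenever the right side and its intermediate products are defined, then the left side and all its intermediate products are defined and the equality holds. *)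

(* Defs.v *)
(* Vanilla Stdlib style: only the Rocq prelude is needed. *)

Set Implicit Arguments.
Unset Strict Implicit.
Unset Printing Implicit Defensive.

(* A set with partial multiplication (X, D, m).  A function on a subset is
   encoded as a function taking a membership proof; by proof irrelevance its
   value does not depend on that proof, so [mul] is a function D -> X. *)
Record partial_mul (X : Type) : Type := PartialMul {
  dom : X -> X -> Prop;
  mul : forall x y : X, dom x y -> X
}.

Definition right_assoc (X : Type) (P : partial_mul X) : Prop :=
  forall (x y z : X) (xy : dom P x y) (xy_z : dom P (mul xy) z),
  exists (yz : dom P y z) (x_yz : dom P x (mul yz)), mul xy_z = mul x_yz.

Definition left_assoc (X : Type) (P : partial_mul X) : Prop :=
  forall (x y z : X) (yz : dom P y z) (x_yz : dom P x (mul yz)),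
  exists (xy : dom P x y) (xy_z : dom P (mul xy) z), mul xy_z = mul x_yz.

Definition assoc (X : Type) (P : partial_mul X) : Prop :=
  right_assoc P /\ left_assoc P.

(* [adom] is the set H, [lact h] is a . u and [ract h] is a ^ u, for a proof
   [h] that (a, u) belongs to H. *)
Record mutual_actions (A U : Type) : Type := MutualActions {
  adom : A -> U -> Prop;
  lact : forall (a : A) (u : U), adom a u -> U;
  ract : forall (a : A) (u : U), adom a u -> A
}.

Section Identities.

Variables (U A : Type) (PU : partial_mul U) (PA : partial_mul A).
Variable M : mutual_actions A U.

(* (ab) . u = a . (b . u) *)
Definition a_fwd : Prop :=
  forall (a b : A) (u : U) (ab : dom PA a b) (ab_u : adom M (mul ab) u),
  exists (bu : adom M b u) (a_bu : adom M a (lact bu)),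
    lact ab_u = lact a_bu.

Definition a_bwd : Prop :=
  forall (a b : A) (u : U) (bu : adom M b u) (a_bu : adom M a (lact bu)),
  exists (ab : dom PA a b) (ab_u : adom M (mul ab) u),
    lact ab_u = lact a_bu.

(* (ab) ^ u = a ^ (b . u) * b ^ u *)
Definition b_fwd : Prop :=
  forall (a b : A) (u : U) (ab : dom PA a b) (ab_u : adom M (mul ab) u),
  exists (bu : adom M b u) (a_bu : adom M a (lact bu))
         (p : dom PA (ract a_bu) (ract bu)),
    ract ab_u = mul p.

Definition b_bwd : Prop :=
  forall (a b : A) (u : U) (bu : adom M b u) (a_bu : adom M a (lact bu))
         (p : dom PA (ract a_bu) (ract bu)),
  exists (ab : dom PA a b) (ab_u : adom M (mul ab) u),
    ract ab_u = mul p.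

(* a . (uv) = (a . u) * (a ^ u . v) *)
Definition c_fwd : Prop :=
  forall (a : A) (u v : U) (uv : dom PU u v) (a_uv : adom M a (mul uv)),
  exists (au : adom M a u) (au_v : adom M (ract au) v)
         (p : dom PU (lact au) (lact au_v)),
    lact a_uv = mul p.

Definition c_bwd : Prop :=
  forall (a : A) (u v : U) (au : adom M a u) (au_v : adom M (ract au) v)
         (p : dom PU (lact au) (lact au_v)),
  exists (uv : dom PU u v) (a_uv : adom M a (mul uv)),
    lact a_uv = mul p.

(* a ^ (uv) = (a ^ u) ^ v *)
Definition d_fwd : Prop :=
  forall (a : A) (u v : U) (uv : dom PU u v) (a_uv : adom M a (mul uv)),
  exists (au : adom M a u) (au_v : adom M (ract au) v),
    ract a_uv = ract au_v.

Definition d_bwd : Prop :=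
  forall (a : A) (u v : U) (au : adom M a u) (au_v : adom M (ract au) v),
  exists (uv : dom PU u v) (a_uv : adom M a (mul uv)),
    ract a_uv = ract au_v.

End Identities.

Section ProductOnE.

Variables (U A : Type) (PU : partial_mul U) (PA : partial_mul A).
Variables (M : mutual_actions A U) (E : U -> A -> Prop).

Definition actions_into_E : Prop :=
  forall (a : A) (u : U) (h : adom M a u), E (lact h) (ract h).

Definition E_mul_left : Prop :=
  forall (u v : U) (a : A) (h : dom PU v u), E u a -> E (mul h) a.

Definition E_mul_right : Prop :=
  forall (u : U) (a b : A) (h : dom PA a b), E u a -> E u (mul h).

Definition E_type : Type := {p : U * A | E (fst p) (snd p)}.

Definition E_fst (x : E_type) : U := fst (proj1_sig x).
Definition E_snd (x : E_type) : A := snd (proj1_sig x).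

(* For x = (u, a) and y = (v, b): when (u, a)(v, b) is defined. *)
Record E_dom (x y : E_type) : Prop := EDom {
  E_dom_act : adom M (E_snd x) (E_fst y);
  E_dom_U : dom PU (E_fst x) (lact E_dom_act);
  E_dom_A : dom PA (ract E_dom_act) (E_snd y)
}.

Hypotheses (hE : actions_into_E) (hl : E_mul_left) (hr : E_mul_right).

(* (u, a)(v, b) = (u (a . v), a ^ v b); the three closure conditions are what
   puts this pair in E. *)
Definition E_mul (x y : E_type) (h : E_dom x y) : E_type :=
  exist (fun p : U * A => E (fst p) (snd p))
    (mul (E_dom_U h), mul (E_dom_A h))
    (hr (E_dom_A h) (hl (E_dom_U h) (hE (E_dom_act h)))).

Definition E_partial_mul : partial_mul E_type := PartialMul E_mul.

End ProductOnE.

(* Main.v *)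
(* The formulas for (xy)z and x(yz) are matched one coordinate at a time: (a)
   and (b) expand the action of the product (a^v) b on w, (c) and (d) contract
   the successive actions of a on v and of a^v on b.w, and associativity of U
   and A moves the brackets.  Passing from functions of membership proofs to
   their graphs makes each of these steps a composition of relations. *)

Require Import Defs.
From Stdlib Require Import ProofIrrelevance Setoid.

Set Implicit Arguments.
Unset Strict Implicit.

Definition product (X : Type) (P : partial_mul X) (x y z : X) : Prop :=
  exists h : dom P x y, mul h = z.

Definition action (A U : Type) (M : mutual_actions A U)
    (a : A) (u : U) (v : U) (b : A) : Prop :=
  exists h : adom M a u, lact h = v /\ ract h = b.

Section PartialMul.

Variables (X : Type) (P : partial_mul X).

Lemma right_assoc_product :
  right_assoc P <->
  forall x y z t s, product P x y t -> product P t z s ->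
  exists r, product P y z r /\ product P x r s.
Proof.
split.
- intros H x y z t s [xy <-] [xy_z <-].
  destruct (H _ _ _ _ xy_z) as [yz [x_yz e]].
  exists (mul yz); split; [exists yz | exists x_yz]; auto.
- intros H x y z xy xy_z.
  destruct (H x y z (mul xy) (mul xy_z)) as [r [[yz <-] [x_yz e]]].
  + exists xy; reflexivity.
  + exists xy_z; reflexivity.
  + exists yz, x_yz; auto.
Qed.

Lemma left_assoc_product :
  left_assoc P <->
  forall x y z r s, product P y z r -> product P x r s ->
  exists t, product P x y t /\ product P t z s.
Proof.
split.
- intros H x y z r s [yz <-] [x_yz <-].
  destruct (H _ _ _ _ x_yz) as [xy [xy_z e]].
  exists (mul xy); split; [exists xy | exists xy_z]; auto.
- intros H x y z yz x_yz.
  destruct (H x y z (mul yz) (mul x_yz)) as [t [[xy <-] [xy_z e]]].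
  + exists yz; reflexivity.
  + exists x_yz; reflexivity.
  + exists xy, xy_z; auto.
Qed.

End PartialMul.

Section Identities.

Variables (U A : Type) (PU : partial_mul U) (PA : partial_mul A).
Variable M : mutual_actions A U.

Lemma action_of_product :
  a_fwd PA M -> b_fwd PA M ->
  forall a b ab u v c, product PA a b ab -> action M ab u v c ->
  exists w b' a', action M b u w b' /\ action M a w v a' /\ product PA a' b' c.
Proof.
intros Ha Hb a b ab u v c [h <-] [k [<- <-]].
destruct (Ha _ _ _ _ k) as [bu [a_bu e]].
destruct (Hb _ _ _ _ k) as [bu' [a_bu' [p e']]].
destruct (proof_irrelevance _ bu bu').
destruct (proof_irrelevance _ a_bu a_bu').
exists (lact bu), (ract bu), (ract a_bu).
split; [exists bu; auto | split; [exists a_bu; auto | exists p; auto]].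
Qed.

Lemma product_of_actions :
  a_bwd PA M -> b_bwd PA M ->
  forall a b u w b' v a' c,
  action M b u w b' -> action M a w v a' -> product PA a' b' c ->
  exists ab, product PA a b ab /\ action M ab u v c.
Proof.
intros Ha Hb a b u w b' v a' c [bu [<- <-]] [a_bu [<- <-]] [p <-].
destruct (Ha _ _ _ _ a_bu) as [h [k e]].
destruct (Hb _ _ _ _ _ p) as [h' [k' e']].
destruct (proof_irrelevance _ h h').
destruct (proof_irrelevance _ k k').
exists (mul h); split; [exists h; auto | exists k; auto].
Qed.

Lemma action_on_product :
  c_fwd PU M -> d_fwd PU M ->
  forall a u v uv w c, product PU u v uv -> action M a uv w c ->
  exists u' a' v', action M a u u' a' /\ action M a' v v' c /\ product PU u' v' w.
Proof.
intros Hc Hd a u v uv w c [h <-] [k [<- <-]].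
destruct (Hc _ _ _ _ k) as [au [au_v [p e]]].
destruct (Hd _ _ _ _ k) as [au' [au_v' e']].
destruct (proof_irrelevance _ au au').
destruct (proof_irrelevance _ au_v au_v').
exists (lact au), (ract au), (lact au_v).
split; [exists au; auto | split; [exists au_v; auto | exists p; auto]].
Qed.

Lemma actions_on_product :
  c_bwd PU M -> d_bwd PU M ->
  forall a u v u' a' v' w c,
  action M a u u' a' -> action M a' v v' c -> product PU u' v' w ->
  exists uv, product PU u v uv /\ action M a uv w c.
Proof.
intros Hc Hd a u v u' a' v' w c [au [<- <-]] [au_v [<- <-]] [p <-].
destruct (Hc _ _ _ _ _ p) as [h [k e]].
destruct (Hd _ _ _ _ au_v) as [h' [k' e']].
destruct (proof_irrelevance _ h h').
destruct (proof_irrelevance _ k k').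
exists (mul h); split; [exists h; auto | exists k; auto].
Qed.

End Identities.

Section ProductOnE.

Variables (U A : Type) (PU : partial_mul U) (PA : partial_mul A).
Variables (M : mutual_actions A U) (E : U -> A -> Prop).
Hypotheses (hE : actions_into_E M E) (hl : E_mul_left PU E).
Hypothesis hr : E_mul_right PA E.

Lemma E_product (x y z : E_type E) :
  product (E_partial_mul hE hl hr) x y z <->
  exists v a, action M (E_snd x) (E_fst y) v a /\
    product PU (E_fst x) v (E_fst z) /\ product PA a (E_snd y) (E_snd z).
Proof.
split.
- intros [[h hU hA] <-].
  exists (lact h), (ract h).
  split; [exists h; auto | split; [exists hU | exists hA]; reflexivity].
- intros [v [a [[h [<- <-]] [[hU eU] [hA eA]]]]].
  exists (EDom hU hA).
  destruct z as [[z1 z2] Ez]; unfold E_fst, E_snd in *; simpl in *; subst.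
  apply subset_eq_compat; reflexivity.
Qed.

Lemma product_in_E (x y : E_type E) v a p q :
  action M (E_snd x) (E_fst y) v a ->
  product PU (E_fst x) v p -> product PA a (E_snd y) q -> E p q.
Proof.
intros [h [<- <-]] [hU <-] [hA <-].
exact (hr hA (hl hU (hE h))).
Qed.

Lemma E_right_assoc :
  right_assoc PU -> right_assoc PA ->
  a_fwd PA M -> b_fwd PA M -> c_bwd PU M -> d_bwd PU M ->
  right_assoc (E_partial_mul hE hl hr).
Proof.
rewrite !right_assoc_product.
intros rU rA Ha Hb Hc Hd x y z t s xy xy_z.
apply E_product in xy as [av [a_v [act_av [u_av av_b]]]].
apply E_product in xy_z as [g [d [act_w [ug dc]]]].
destruct (action_of_product Ha Hb av_b act_w)
  as [bw [b_w [a' [act_bw [act_abw a'_bw]]]]].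
destruct (rU _ _ _ _ _ u_av ug) as [m [av_g um]].
destruct (actions_on_product Hc Hd act_av act_abw av_g) as [n [v_bw act_n]].
destruct (rA _ _ _ _ _ a'_bw dc) as [k [bw_c a'_k]].
exists (exist _ (n, k) (product_in_E act_bw v_bw bw_c)).
split; apply E_product.
- exists bw, b_w; auto.
- exists m, a'; auto.
Qed.

Lemma E_left_assoc :
  left_assoc PU -> left_assoc PA ->
  a_bwd PA M -> b_bwd PA M -> c_fwd PU M -> d_fwd PU M ->
  left_assoc (E_partial_mul hE hl hr).
Proof.
rewrite !left_assoc_product.
intros lU lA Ha Hb Hc Hd x y z r s yz x_yz.
apply E_product in yz as [bw [b_w [act_bw [v_bw bw_c]]]].
apply E_product in x_yz as [m [a' [act_n [um a'_k]]]].
destruct (action_on_product Hc Hd v_bw act_n)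
  as [av [a_v [g [act_av [act_abw av_g]]]]].
destruct (lA _ _ _ _ _ bw_c a'_k) as [d [a'_bw dc]].
destruct (product_of_actions Ha Hb act_bw act_abw a'_bw) as [k [av_b act_w]].
destruct (lU _ _ _ _ _ av_g um) as [n [u_av ng]].
exists (exist _ (n, k) (product_in_E act_av u_av av_b)).
split; apply E_product.
- exists av, a_v; auto.
- exists g, d; auto.
Qed.

End ProductOnE.

Theorem lemma3p8 (U A : Type) (PU : partial_mul U) (PA : partial_mul A)
  (M : mutual_actions A U) (E : U -> A -> Prop)
  (hE : actions_into_E M E) (hl : E_mul_left PU E) (hr : E_mul_right PA E) :
  (right_assoc PU -> right_assoc PA ->
   a_fwd PA M -> b_fwd PA M -> c_bwd PU M -> d_bwd PU M ->
   right_assoc (E_partial_mul hE hl hr))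
  /\
  (left_assoc PU -> left_assoc PA ->
   a_bwd PA M -> b_bwd PA M -> c_fwd PU M -> d_fwd PU M ->
   left_assoc (E_partial_mul hE hl hr))
  /\
  (assoc PU -> assoc PA ->
   a_fwd PA M -> a_bwd PA M -> b_fwd PA M -> b_bwd PA M ->
   c_fwd PU M -> c_bwd PU M -> d_fwd PU M -> d_bwd PU M ->
   assoc (E_partial_mul hE hl hr)).
Proof.
split; [apply E_right_assoc | split; [apply E_left_assoc |]].
intros [rU lU] [rA lA] Ha Ha' Hb Hb' Hc Hc' Hd Hd'.
split; [apply E_right_assoc | apply E_left_assoc]; assumption.
Qed.
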